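(* There exists an $(11,35,8)$ tree-code, i.e. a set of $35$ spanning trees of the complete graph on $11$ labelled vertices whose pairwise tree-distances are all at least $8$; hence $A(11,8)\ge35$.
   Context: For spanning trees $T_1=(V,E_1)$, $T_2=(V,E_2)$ of the complete graph on a labelled vertex set $V$ with $|V|=n$, the tree-distance is $d(T_1,T_2)=n-1-|E_1\cap E_2|$. An $(n,M,d)$ tree-code is a set of $M$ such spanning trees with pairwise tree-distance at least $d$, and $A(n,d)$ is the maximum size of a set of spanning trees on $n$ labelled vertices with pairwise tree-distance at least $d$. *)

(* Defs.v *)
From mathcomp Require Import all_boot.

Set Implicit Arguments.
Unset Strict Implicit.
Unset Printing Implicit Defensive.

(* A graph on the finite vertex set V is represented by its set of edges, an
   edge being a two-element set of vertices. *)
Section Trees.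
Variable V : finType.
Implicit Types E : {set {set V}}.

Definition complete_edges : {set {set V}} := [set e : {set V} | #|e| == 2].

Definition adj E : rel V := fun x y => [set x; y] \in E.

Definition connected E : bool := [forall x, forall y, connect (adj E) x y].

(* A cycle is a cyclic sequence of at least three distinct vertices, any two
   consecutive ones being adjacent (a single edge x, y counts as a two-element
   ucycle).  Such a sequence has at most #|V| entries, so bounding the length
   loses nothing and makes the predicate decidable; see acyclicP. *)
Definition acyclic E : bool :=
  [forall k : 'I_#|V|.+1, forall c : k.-tuple V,
     ucycleb (adj E) c ==> (k <= 2)].

Lemma acyclicP E :
  reflect (forall c : seq V, ucycle (adj E) c -> size c <= 2) (acyclic E).
Proof.
apply: (iffP forallP) => [H c Uc | H k].
  have le_c : size c < #|V|.+1.
    by rewrite ltnS; case/andP: Uc => _ /card_uniqP <-; exact: max_card.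
  by have /forallP/(_ (in_tuple c))/implyP/(_ Uc) := H (Ordinal le_c).
by apply/forallP => c; apply/implyP => /H; rewrite size_tuple.
Qed.

Definition spanning_tree E : bool :=
  [&& E \subset complete_edges, connected E & acyclic E].

Definition tree_dist E1 E2 : nat := #|V| - 1 - #|E1 :&: E2|.

End Trees.

Definition tree_code (n M d : nat) (C : {set {set {set 'I_n}}}) : bool :=
  [&& #|C| == M,
      [forall T in C, spanning_tree T]
    & [forall T1 in C, forall T2 in C, (T1 != T2) ==> (d <= tree_dist T1 T2)]].

Arguments tree_code : clear implicits.

Definition A (n d : nat) : nat :=
  \max_(C : {set {set {set 'I_n}}} | tree_code n #|C| d C) #|C|.

(* Main.v *)
Require Import Defs.
From mathcomp Require Import all_boot.

Set Implicit Arguments.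
Unset Strict Implicit.
Unset Printing Implicit Defensive.

(** The code is found by prescribing a symmetry.  Let the cyclic group of
    order 7 rotate the vertices 0, ..., 6 and fix 7, 8, 9, 10.  A computer
    search for five trees whose orbits under this group are compatible yields
    5 * 7 = 35 trees, any two of which share at most two of their ten edges,
    so that their distance is at least 10 - 2 = 8.

    What remains is to verify the five trees.  Each of them is rooted at the
    fixed vertex 10 and stored as the table of its parent map f, and its
    rotations are conjugates of f.  If every iteration of f ends at the root,
    the edges {x, f x} form a spanning tree with one edge per non-root vertex
    ([rooted_tree_spanning], [card_rooted_tree]).  An edge of the trees of f
    and g is {x, f x} with either f x = g x or g (f x) = x, so that common
    edges are counted by running over the vertices ([card_common_edges]).
    Both tests are evaluated on natural numbers ([tree_code_of_tables]). *)

(** * Trees given by a parent map *)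

Section RootedTree.
Variables (V : finType) (r : V).
Implicit Types f g : V -> V.

Definition rooted_tree f : {set {set V}} := [set [set x; f x] | x in predC1 r].

Section ParentMap.
Variables (f : V -> V) (N : nat).
Hypotheses (fr : f r = r) (f_root : forall x, iter N f x = r).

(** As r is a fixed point, this is the number of steps from x to the root. *)
Definition depth (x : V) : nat := \sum_(0 <= k < N) (iter k f x != r).

(** A sum of N + 1 terms is split at either end: its last term vanishes because
    [iter N f x = r], and its first one is 1 because x is not the root. *)
Lemma depth_parent x : x != r -> depth x = (depth (f x)).+1.
Proof.
move=> xr; have := erefl (\sum_(0 <= k < N.+1) (iter k f x != r)).
rewrite {1}big_nat_recr //= f_root eqxx addn0 -/(depth x) => ->.
rewrite big_nat_recl //= xr add1n; congr _.+1.
by apply: eq_bigr => k _; rewrite -iterS iterSr.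
Qed.

Lemma parent_neq x : x != r -> f x != x.
Proof. by move/depth_parent; apply: contra_eq_neq => ->; rewrite neq_ltn ltnSn. Qed.

Lemma adj_rooted_tree x y :
  adj (rooted_tree f) x y -> (x != r) && (y == f x) || (y != r) && (x == f y).
Proof.
case/imsetP => z; rewrite inE => zr E.
have := set21 x y; have := set22 x y; rewrite E !inE.
move=> /orP[]/eqP Ey /orP[]/eqP Ex; subst x y.
- by have := set22 z (f z); rewrite -E setUid inE (negPf (parent_neq zr)).
- by rewrite zr eqxx orbT.
- by rewrite zr eqxx.
- by have := set21 z (f z); rewrite -E setUid inE eq_sym (negPf (parent_neq zr)).
Qed.

(** A neighbour that is not deeper is the parent. *)
Lemma adj_parent x y :
  adj (rooted_tree f) x y -> depth y <= depth x -> y = f x.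
Proof.
case/adj_rooted_tree/orP => /andP[nr /eqP E] // le_yx.
by move: le_yx; rewrite (depth_parent nr) -E ltnn.
Qed.

(** Both neighbours of a deepest vertex on a cycle would be its parent. *)
Lemma rooted_tree_acyclic : acyclic (rooted_tree f).
Proof.
apply/acyclicP => c /andP[cyc_c uniq_c]; rewrite leqNgt; apply/negP => c3.
have [x0 x0c] : exists x0, x0 \in c.
  by case: c c3 {cyc_c uniq_c} => // x0 c _; exists x0; rewrite mem_head.
case: (arg_maxnP depth x0c) => x xc x_max.
(* Rotated to start at x, the cycle reads x, y, ..., last z s. *)
have [i s Ec] := rot_to xc.
have mem_s y : y \in x :: s -> depth y <= depth x.
  by rewrite -Ec mem_rot => /x_max.
move: cyc_c uniq_c c3; rewrite -(rot_cycle i) -(rot_uniq i) -(size_rot i) Ec.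
case: s mem_s {Ec} => [|y [|z s]] // mem_s.
rewrite /cycle rcons_cons /= rcons_path => /and3P[xy _ /andP[_ lx]].
move=> /and3P[_ + _] _ => /negP; apply.
have -> : y = f x by apply: adj_parent => //; apply: mem_s; rewrite !inE eqxx orbT.
have <- : last z s = f x; last exact: mem_last.
apply: adj_parent; first by rewrite /adj setUC.
by apply: mem_s; rewrite 2!in_cons mem_last !orbT.
Qed.

Lemma rooted_tree_connected : connected (rooted_tree f).
Proof.
have sym_adj : symmetric (adj (rooted_tree f)).
  by move=> x y; rewrite /adj setUC.
have to_parent x : connect (adj (rooted_tree f)) x (f x).
  have [-> | xr] := eqVneq x r; first by rewrite fr.
  by apply/connect1/imsetP; exists x.
have to_root x : connect (adj (rooted_tree f)) x r.
  rewrite -(f_root x); elim: N => //= k /connect_trans; exact.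
apply/forallP => x; apply/forallP => y; apply: connect_trans (to_root x) _.
by rewrite (sym_connect_sym sym_adj).
Qed.

Lemma rooted_tree_spanning : spanning_tree (rooted_tree f).
Proof.
rewrite /spanning_tree rooted_tree_connected rooted_tree_acyclic !andbT.
apply/subsetP => _ /imsetP[x xr ->].
by rewrite inE cards2 (eq_sym x) parent_neq.
Qed.

Lemma card_rooted_tree : #|rooted_tree f| = #|V|.-1.
Proof.
rewrite card_in_imset ?cardC1 // => x y; rewrite !inE => xr yr E.
have := set21 x (f x); rewrite E !inE => /orP[/eqP // | /eqP xy].
have := set21 y (f y); rewrite -E !inE => /orP[/eqP // | /eqP yx].
by have := depth_parent xr; rewrite -yx (depth_parent yr) -xy => /esym/eqP;
  rewrite gtn_eqF // ltnS ltnW.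
Qed.

End ParentMap.

(** If {x, f x} = {y, g y} then either x = y and f x = g x, or the edge is
    directed oppositely by the two trees, that is y = f x and x = g y. *)
Lemma card_common_edges f g :
  #|rooted_tree f :&: rooted_tree g|
    <= #|[pred x | (x != r) && ((f x == g x) || (g (f x) == x))]|.
Proof.
apply: leq_trans (leq_imset_card (fun x => [set x; f x]) _).
apply/subset_leq_card/subsetP => e /setIP[/imsetP[x xr ->] /imsetP[y yr E]].
apply/imsetP; exists x => //; move: xr; rewrite !inE => -> /=.
have [xy | nxy] := eqVneq x y.
  subst y; have := set22 x (f x); rewrite E !inE => /orP[/eqP fx | -> //].
  have := set22 x (g x); rewrite -E !inE fx eq_sym orbb => ->; exact.
have := set21 x (f x); rewrite E !inE (negPf nxy) => /eqP xg.
have := set21 y (g y); rewrite -E !inE eq_sym (negPf nxy) => /eqP <-.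
by rewrite -xg eqxx orbT.
Qed.

End RootedTree.

(** * Codes given by parent tables *)

Section Tables.
Variable n : nat.
Implicit Types p q : seq nat.

(** A table lists the parents of 0, ..., n - 1; the default value n of [nth]
    makes the root n its own parent. *)
Definition parent p : nat -> nat := nth n p.

Definition table_ok p : bool :=
  [&& size p <= n, all (leq^~ n) p
    & all (fun x => iter n (parent p) x == n) (iota 0 n)].

Definition common p q : nat :=
  count (fun x => (parent p x == parent q x) || (parent q (parent p x) == x))
        (iota 0 n).

Definition parent_ord p (x : 'I_n.+1) : 'I_n.+1 := inord (parent p x).

Definition table_tree p : {set {set 'I_n.+1}} :=
  rooted_tree ord_max (parent_ord p).

Lemma val_parent_ord p x : table_ok p -> val (parent_ord p x) = parent p x.
Proof.
case/and3P => _ /allP le_p _; rewrite /parent_ord /= inordK // ltnS /parent.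
have [lt_xp | ge_xp] := ltnP x (size p); first exact: le_p (mem_nth _ lt_xp).
by rewrite nth_default.
Qed.

Lemma parent_ord_root p : table_ok p -> parent_ord p ord_max = ord_max.
Proof.
move=> ok_p; apply: val_inj; rewrite val_parent_ord //.
by case/andP: ok_p => sz_p _; apply: nth_default.
Qed.

Lemma iter_parent_ord p x : table_ok p -> iter n (parent_ord p) x = ord_max.
Proof.
move=> ok_p; have [-> | x_neq] := eqVneq x ord_max.
  by rewrite iter_fix // parent_ord_root.
apply: val_inj; have -> k : val (iter k (parent_ord p) x) = iter k (parent p) x.
  by elim: k => //= k <-; apply: val_parent_ord.
case/and3P: ok_p => _ _ /allP root_p; apply/eqP/root_p.
by rewrite mem_iota /= ltn_neqAle -ltnS ltn_ord andbT.
Qed.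

Lemma table_tree_spanning p : table_ok p -> spanning_tree (table_tree p).
Proof.
move=> ok_p; apply: (@rooted_tree_spanning _ _ _ n); first exact: parent_ord_root.
by move=> x; apply: iter_parent_ord.
Qed.

Lemma card_table_tree p : table_ok p -> #|table_tree p| = n.
Proof.
move=> ok_p; rewrite (@card_rooted_tree _ _ _ n) ?card_ord // => x.
exact: iter_parent_ord.
Qed.

Lemma card_common_table p q : table_ok p -> table_ok q ->
  #|table_tree p :&: table_tree q| <= common p q.
Proof.
move=> ok_p ok_q; apply: leq_trans (card_common_edges _ _ _) _.
pose P x := (parent p x == parent q x) || (parent q (parent p x) == x).
rewrite (@eq_card _ _ [pred x : 'I_n.+1 | (val x != n) && P x]); last first.
  by move=> x; rewrite !inE -!(inj_eq val_inj) !val_parent_ord.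
rewrite cardE size_filter -enumT.
rewrite -(@count_map _ _ val (fun x => (x != n) && P x)) val_enum_ord.
rewrite -addn1 iotaD count_cat /= add0n eqxx /= !addn0.
by apply: sub_count => x /andP[].
Qed.

(** Distinct tables give distinct trees because a tree shares all its n edges
    with itself, whereas two entries of [ps] share at most n - d < n edges. *)
Lemma tree_code_of_tables d (ps : seq (seq nat)) :
    0 < d -> all table_ok ps -> pairwise (fun p q => common p q + d <= n) ps ->
  tree_code n.+1 (size ps) d [set T in map table_tree ps].
Proof.
move=> d0 all_ok far_ps; have ok_ps := allP all_ok.
pose far (T1 T2 : {set {set 'I_n.+1}}) := #|T1 :&: T2| + d <= n.
have far_trees : pairwise far (map table_tree ps).
  rewrite pairwise_map; apply: (sub_in_pairwise _ all_ok) far_ps => p q ok_p ok_q.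
  by apply: leq_trans; rewrite leq_add2r card_common_table.
have uniq_trees : uniq (map table_tree ps).
  rewrite uniq_pairwise.
  apply: (sub_in_pairwise _ (allss _)) far_trees => _ T2 /mapP[p p_ps ->] _.
  apply: contraTneq => <-.
  by rewrite /far setIid card_table_tree ?ok_ps // -ltnNge -addn1 leq_add2l.
have far_sym T1 T2 : far T1 T2 = far T2 T1 by rewrite /far setIC.
apply/and3P; split.
- by rewrite cardsE (card_uniqP uniq_trees) size_map.
- apply/forall_inP => T; rewrite inE => /mapP[p p_ps ->].
  exact: table_tree_spanning (ok_ps _ p_ps).
apply/forall_inP => T1; rewrite inE => T1_C.
apply/forall_inP => T2; rewrite inE => T2_C; apply/implyP => neqT.
have /(leq_sub2r #|T1 :&: T2|) : far T1 T2.
  move: T1_C T2_C neqT => /(nthP set0)[i i_lt <-] /(nthP set0)[j j_lt <-].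
  have /(pairwiseP set0) far_lt := far_trees.
  case: (ltngtP i j) => [ij _ | ji _ | ->]; last by rewrite eqxx.
    exact: far_lt.
  by rewrite far_sym; apply: far_lt.
by rewrite addKn /tree_dist card_ord subn1.
Qed.

End Tables.

(** * The five base trees and their rotations *)

Definition rotate (k x : nat) : nat := if x < 7 then (x + k) %% 7 else x.

(** Rotating a tree conjugates its parent map; the inverse of the rotation by
    k is the rotation by 7 - k. *)
Definition rotate_table (k : nat) (p : seq nat) : seq nat :=
  [seq rotate k (parent 10 p (rotate (7 - k) x)) | x <- iota 0 10].

Definition base_tables : seq (seq nat) :=
  [:: [:: 1; 10; 10; 4; 8; 3; 8; 2; 9; 1];
      [:: 7; 9; 4; 0; 5; 10; 8; 5; 5; 10];
      [:: 1; 3; 5; 10; 9; 1; 5; 8; 5; 5];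
      [:: 2; 10; 4; 9; 10; 1; 7; 0; 2; 7];
      [:: 5; 5; 4; 5; 8; 10; 0; 4; 10; 2]].

Definition code_tables : seq (seq nat) :=
  [seq rotate_table k p | p <- base_tables, k <- iota 0 7].

Theorem mainTheorem8 :
  (exists C : {set {set {set 'I_11}}}, tree_code 11 35 8 C) /\ 35 <= A 11 8.
Proof.
have C_code : tree_code 11 35 8 [set T in map (@table_tree 10) code_tables].
  by apply: (@tree_code_of_tables 10 8 code_tables) => //; vm_compute.
split; first by exists [set T in map (@table_tree 10) code_tables].
have /eqP card_C := proj1 (andP C_code).
by rewrite -{1}card_C; apply: leq_bigmax_cond; rewrite card_C.
Qed.
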